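(* Let $\cong$ be a congruence on LTSs such that $L\doteq L'$ implies $L\cong L'$, and $B\not\cong V$. Then $\cong$ preserves $\mathit{Sf}$.
   Context: An LTS is a tuple $L=(S,\Sigma,\Delta,\hat s)$ with states $S$, alphabet $\Sigma$ (possibly infinite), $\tau\notin\Sigma$ a reserved invisible action, transitions $\Delta\subseteq S\times(\Sigma\cup\{\tau\})\times S$, initial state $\hat s$; $\Sigma(L)$ denotes the alphabet. Operators: action prefix $a.L$ ($a\neq\tau$): new initial state $\hat s'$, alphabet $\Sigma\cup\{a\}$, transitions $\Delta\cup\{(\hat s',a,\hat s)\}$. Hiding $L\setminus A$: alphabet $\Sigma\setminus A$, each transition labelled by an element of $A$ relabelled $\tau$, otherwise unchanged. Relational renaming $L\Phi$ ($\Phi$ a set of pairs, $\tau$ not in its domain $\mathcal D(\Phi)$ or range; $\Phi(a,b)$ means $(a,b)\in\Phi$ or $a=b\notin\mathcal D(\Phi)$): alphabet $\{b\mid\exists a\in\Sigma:\Phi(a,b)\}$, transitions $\{(s,b,s')\mid\exists a:(s,a,s')\in\Delta\wedge\Phi(a,b)\}$, same states and initial state. Parallel composition $L_1\|L_2$: states $S_1\times S_2$, alphabet $\Sigma_1\cup\Sigma_2$, initial $(\hat s_1,\hat s_2)$; actions in $\Sigma_1\cap\Sigma_2$ are taken jointly by both components, all other actions (including $\tau$) by one component while the other stays put. A congruence is an equivalence $\cong$ with $L\cong L'\Rightarrow a.L\cong a.L',\ L\setminus A\cong L'\setminus A,\ L\Phi\cong L'\Phi,\ L\|L''\cong L'\|L'',\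 L''\|L\cong L''\|L'$. For $\sigma=a_1\cdots a_n\in\Sigma^*$, $s\stackrel{\sigma}{\Rightarrow}s'$ means a finite path from $s$ to $s'$ whose non-$\tau$ labels are exactly $a_1,\dots,a_n$ in order; $\hat s\stackrel{\xi}{\Rightarrow}$ for $\xi\in\Sigma^\omega$ means an infinite path from $\hat s$ whose non-$\tau$ label sequence is $\xi$; $s\stackrel{\tau^\omega}{\to}$ means an infinite path of $\tau$-transitions from $s$. Define $\mathit{Tr}(L)=\{\sigma\in\Sigma^*\mid\exists s:\hat s\stackrel\sigma\Rightarrow s\}$, $\mathit{Div}(L)=\{\sigma\in\Sigma^*\mid\exists s:\hat s\stackrel\sigma\Rightarrow s\wedge s\stackrel{\tau^\omega}\to\}$, $\mathit{Inf}(L)=\{\xi\in\Sigma^\omega\mid\hat s\stackrel\xi\Rightarrow\}$, $\mathit{Sf}(L)=\{(\sigma,A)\in\Sigma^*\times2^\Sigma\mid\exists s:\hat s\stackrel\sigma\Rightarrow s\wedge\forall a\in A\cup\{\tau\}\,\forall s':(s,a,s')\notin\Delta\}$. $L\doteq L'$ (CFFD-equivalence) iff $\Sigma,\mathit{Sf},\mathit{Div},\mathit{Inf}$ all agree on $L$ and $L'$. An equivalence preserves $X$ if $L\cong L'\Rightarrow X(L)=X(L')$. $V$ is the one-state LTS with empty alphabet and a single $\tau$ self-loop; $B$ is the LTS with empty alphabet, states $s_0$ (initial) and $s_1$, and transitions $(s_0,\tau,s_0)$, $(s_0,\tau,s_1)$ (so $\mathit{Sf}(B)=\{(\varepsilon,\emptyset)\}$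 and $\mathit{Div}(B)=\{\varepsilon\}$). *)

(* Defs.v *)
From Corelib Require Import RelationClasses.
From mathcomp Require Import all_boot.
From mathcomp Require Import classical_sets.

Set Implicit Arguments.
Unset Strict Implicit.
Unset Printing Implicit Defensive.

Local Open Scope classical_set_scope.

(* [Act] is the universe of visible actions from which all alphabets are
   drawn. A label is an [option Act]: [Some a] is the visible action [a] and
   [None] is the invisible action tau, so tau is in no alphabet. *)
Record LTS (Act : Type) := MkLTS {
  state : Type;
  alphabet : set Act;
  trans : state -> option Act -> state -> Prop;
  init : state;
  trans_alphabet : forall s a s', trans s (Some a) s' -> alphabet a }.

Section Operators.
Variable Act : Type.
Implicit Types (L : LTS Act) (a b : Act) (l : option Act) (A : set Act).

(* The new initial state is [None]; the old state [s] becomes [Some s]. *)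
Definition prefix_trans a L (s : option (state L)) l (s' : option (state L)) :
    Prop :=
  match s, s' with
  | None, Some t' => l = Some a /\ t' = init L
  | Some t, Some t' => trans t l t'
  | _, None => False
  end.

Lemma prefix_trans_alphabet a L s b s' :
  @prefix_trans a L s (Some b) s' -> ([set a] `|` alphabet L) b.
Proof.
case: s s' => [s|] [s'|] //=; first by move=> st; right; exact: trans_alphabet st.
by case=> -[->] _; left.
Qed.

Definition action_prefix a L : LTS Act :=
  {| state := option (state L);
     alphabet := [set a] `|` alphabet L;
     trans := @prefix_trans a L;
     init := None;
     trans_alphabet := @prefix_trans_alphabet a L |}.

Definition hide_trans A L (s : state L) l (s' : state L) : Prop :=
  match l with
  | Some a => trans s (Some a) s' /\ ~ A a
  | None => trans s None s' \/ exists2 a, A a & trans s (Some a) s'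
  end.

Lemma hide_trans_alphabet A L s a s' :
  @hide_trans A L s (Some a) s' -> (alphabet L `\` A) a.
Proof. by case=> st nAa; split=> //; exact: trans_alphabet st. Qed.

Definition hide L A : LTS Act :=
  {| state := state L;
     alphabet := alphabet L `\` A;
     trans := @hide_trans A L;
     init := init L;
     trans_alphabet := @hide_trans_alphabet A L |}.

Definition ren_dom (Phi : set (Act * Act)) : set Act :=
  [set a | exists b, Phi (a, b)].

Definition ren_act (Phi : set (Act * Act)) a b : Prop :=
  Phi (a, b) \/ (a = b /\ ~ ren_dom Phi a).

Definition ren_label (Phi : set (Act * Act)) l l' : Prop :=
  match l, l' with
  | Some a, Some b => ren_act Phi a b
  | None, None => True
  | _, _ => False
  end.

Definition ren_alphabet (Phi : set (Act * Act)) L : set Act :=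
  [set b | exists2 a, alphabet L a & ren_act Phi a b].

Definition ren_trans (Phi : set (Act * Act)) L (s : state L) l' (s' : state L) :
    Prop :=
  exists2 l, trans s l s' & ren_label Phi l l'.

Lemma ren_trans_alphabet Phi L s b s' :
  @ren_trans Phi L s (Some b) s' -> ren_alphabet Phi L b.
Proof.
by case=> -[a|] //= st Phiab; exists a => //; exact: trans_alphabet st.
Qed.

Definition rename L (Phi : set (Act * Act)) : LTS Act :=
  {| state := state L;
     alphabet := ren_alphabet Phi L;
     trans := @ren_trans Phi L;
     init := init L;
     trans_alphabet := @ren_trans_alphabet Phi L |}.

Definition shared L1 L2 l : Prop :=
  if l is Some a then (alphabet L1 `&` alphabet L2) a else False.

Definition par_trans L1 L2 (s : state L1 * state L2) l
    (s' : state L1 * state L2) : Prop :=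
  [\/ [/\ shared L1 L2 l, trans s.1 l s'.1 & trans s.2 l s'.2],
      [/\ ~ shared L1 L2 l, trans s.1 l s'.1 & s'.2 = s.2] |
      [/\ ~ shared L1 L2 l, trans s.2 l s'.2 & s'.1 = s.1]].

Lemma par_trans_alphabet L1 L2 s a s' :
  @par_trans L1 L2 s (Some a) s' -> (alphabet L1 `|` alphabet L2) a.
Proof.
by case=> -[_ st _]; [left|left|right]; exact: trans_alphabet st.
Qed.

Definition par L1 L2 : LTS Act :=
  {| state := (state L1 * state L2)%type;
     alphabet := alphabet L1 `|` alphabet L2;
     trans := @par_trans L1 L2;
     init := (init L1, init L2);
     trans_alphabet := @par_trans_alphabet L1 L2 |}.

End Operators.

Section Semantics.
Variables (Act : Type) (L : LTS Act).

Fixpoint run (s : state L) (ls : seq (option Act)) (s' : state L) : Prop :=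
  if ls is l :: ls' then exists2 t, trans s l t & run t ls' s' else s = s'.

(* [pmap id] drops the tau labels. *)
Definition weak (s : state L) (sigma : seq Act) (s' : state L) : Prop :=
  exists2 ls, run s ls s' & pmap id ls = sigma.

Definition inf_run (s : state L) (ls : nat -> option Act) : Prop :=
  exists2 p : nat -> state L, p 0 = s & forall i, trans (p i) (ls i) (p i.+1).

(* [f] enumerates in increasing order the positions of the visible labels of
   [ls], and the visible labels at these positions spell [xi]. *)
Definition visible_word (ls : nat -> option Act) (xi : nat -> Act) : Prop :=
  exists f : nat -> nat,
    [/\ forall n, f n < f n.+1,
        forall n, ls (f n) = Some (xi n) &
        forall i, ls i <> None -> exists n, f n = i].

Definition diverges (s : state L) : Prop := inf_run s (fun=> None).

(* The words in [Div], [Inf] and [Sf] are automatically over [alphabet L], by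
   [trans_alphabet]. *)
Definition Div : set (seq Act) :=
  [set sigma | exists2 s, weak (init L) sigma s & diverges s].

Definition Inf : set (nat -> Act) :=
  [set xi | exists2 ls, inf_run (init L) ls & visible_word ls xi].

Definition Sf : set (seq Act * set Act) :=
  [set r | r.2 `<=` alphabet L /\
    exists s, [/\ weak (init L) r.1 s,
                  forall s', ~ trans s None s' &
                  forall a, r.2 a -> forall s', ~ trans s (Some a) s']].

End Semantics.

Definition cffd_equiv (Act : Type) (L L' : LTS Act) : Prop :=
  [/\ alphabet L = alphabet L', Sf L = Sf L', Div L = Div L' & Inf L = Inf L'].

Record is_congruence (Act : Type) (R : LTS Act -> LTS Act -> Prop) : Prop := {
  cong_equivalence : Equivalence R;
  cong_prefix : forall a L L', R L L' -> R (action_prefix a L) (action_prefix a L');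
  cong_hide : forall A L L', R L L' -> R (hide L A) (hide L' A);
  cong_rename : forall Phi L L', R L L' -> R (rename L Phi) (rename L' Phi);
  cong_parl : forall L'' L L', R L L' -> R (par L L'') (par L' L'');
  cong_parr : forall L'' L L', R L L' -> R (par L'' L) (par L'' L') }.

Definition preserves (Act T : Type) (R : LTS Act -> LTS Act -> Prop)
    (X : LTS Act -> T) : Prop :=
  forall L L', R L L' -> X L = X L'.

Section BasicLTSs.
Variable Act : Type.

Definition V_trans (s : unit) (l : option Act) (s' : unit) : Prop := l = None.

Lemma V_trans_alphabet s a s' : V_trans s (Some a) s' -> (set0 : set Act) a.
Proof. by []. Qed.

Definition lts_V : LTS Act :=
  {| state := unit;
     alphabet := set0;
     trans := V_trans;
     init := tt;
     trans_alphabet := V_trans_alphabet |}.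

Inductive B_state := B_s0 | B_s1.

Inductive B_trans : B_state -> option Act -> B_state -> Prop :=
  | B_trans00 : B_trans B_s0 None B_s0
  | B_trans01 : B_trans B_s0 None B_s1.

Lemma B_trans_alphabet s a s' : B_trans s (Some a) s' -> (set0 : set Act) a.
Proof. by move=> H; inversion H. Qed.

Definition lts_B : LTS Act :=
  {| state := B_state;
     alphabet := set0;
     trans := B_trans;
     init := B_s0;
     trans_alphabet := B_trans_alphabet |}.

End BasicLTSs.

(* Main.v *)
From Stdlib Require List.
From mathcomp Require Import all_boot.
From mathcomp Require Import boolp classical_sets.
Require Import Defs.

(** If [(sigma, A)] is a stable failure of [K], run [K] in parallel with a
    tester that follows [sigma], diverges before having completed it, and then
    offers [A], diverging after any action of [A]; finally hide everything.
    The result is CFFD-equivalent to [B] or to [V] according to whether [K] has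
    a stable state passing the test, so congruent LTSs pass the same tests.

    The alphabets of congruent [L] and [L'] may differ, and the tester then
    performs the actions foreign to [L'] on its own.  Hence all refusals of [L]
    consist of actions of [L'], but for [(sigma, A)] in [Sf L] the test only
    yields [(sigma', A)] in [Sf L'], where [sigma'] could lack a letter [a] of
    [sigma] not in the alphabet of [L'].  In that case no stable state of [L]
    refuses [a], so hiding [a] destroys all stable states of [L] and none of
    [L'], which a further test detects. *)

Set Implicit Arguments.
Unset Strict Implicit.
Unset Printing Implicit Defensive.

Local Open Scope classical_set_scope.

(** * Runs, weak transitions and reachable stable states *)

Section Runs.
Variables (Act : Type) (L : LTS Act).
Implicit Types (s t : state L) (ls : seq (option Act)) (w : seq Act).

Definition stable s : Prop := forall s', ~ trans s None s'.

Definition has_stable : Prop :=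
  exists2 s, (exists ls, run (init L) ls s) & stable s.

Lemma run_rcons s ls t l s' :
  run s ls t -> trans t l s' -> run s (rcons ls l) s'.
Proof.
elim: ls s => [|l' ls IH] s /=; first by move=> -> st; exists s'.
by case=> u su /IH ut /ut us'; exists u.
Qed.

Lemma run_inv (P : state L -> Prop) s ls s' :
  (forall t l t', P t -> trans t l t' -> P t') -> P s -> run s ls s' -> P s'.
Proof.
move=> Pstep; elim: ls s => [|l ls IH] s Ps /=; first by move=> <-.
by case=> t /(Pstep _ _ _ Ps)/IH.
Qed.

Lemma weak_refl s : weak s [::] s.
Proof. by exists [::]. Qed.

Lemma weak_tau s w t s' : weak s w t -> trans t None s' -> weak s w s'.
Proof.
case=> ls st <- ts'; exists (rcons ls None); first exact: run_rcons ts'.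
by rewrite -cats1 pmap_cat cats0.
Qed.

Lemma weak_rcons s w t a s' :
  weak s w t -> trans t (Some a) s' -> weak s (rcons w a) s'.
Proof.
case=> ls st <- ts'; exists (rcons ls (Some a)); first exact: run_rcons ts'.
by rewrite -!cats1 pmap_cat.
Qed.

Lemma weak_alphabet s w s' : weak s w s' -> [set a | List.In a w] `<=` alphabet L.
Proof.
case=> ls + <- a /=; elim: ls s => [//|l ls IH] s /= [t st ts'].
case: l st => [b|] /= st; last exact: IH ts'.
by case=> [<-|]; [exact: trans_alphabet st | exact: IH ts'].
Qed.

Lemma has_stableP : has_stable <-> Sf L !=set0.
Proof.
split=> [[s [ls init_s] stable_s]|[[w A] [_ [s [[ls init_s _] stable_s _]]]]].
  exists (pmap id ls, set0); split; first exact: sub0set.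
  by exists s; split=> //; exists ls.
by exists s => //; exists ls.
Qed.

End Runs.

(** * Initially divergent LTSs over the empty alphabet *)

Section EmptyAlphabet.
Variable Act : Type.
Implicit Types M N : LTS Act.

Lemma weak_nil M s w s' : alphabet M = set0 -> @weak Act M s w s' -> w = [::].
Proof.
move=> M0 /weak_alphabet; rewrite M0; case: w => // a w /(_ a); case.
by left.
Qed.

Lemma Inf_empty_alphabet M : alphabet M = set0 -> Inf M = set0.
Proof.
move=> M0; rewrite -subset0 => xi [ls [p _ plsp] [f [_ lsf _]]].
have := plsp (f 0); rewrite lsf => st.
by have := trans_alphabet st; rewrite M0.
Qed.

Lemma Div_empty_alphabet M :
  alphabet M = set0 -> diverges (init M) -> Div M = [set [::]].
Proof.
move=> M0 Mdiv; apply/seteqP; split=> [w [s]|_ ->]; first by move/(weak_nil M0).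
by exists (init M) => //; exact: weak_refl.
Qed.

Lemma Sf_empty_alphabet M : alphabet M = set0 ->
  Sf M = [set r | r = ([::], set0) /\ has_stable M].
Proof.
move=> M0; apply/seteqP; split=> [[w A] SfwA|_ [-> [s [ls init_s] stable_s]]].
  split; last by apply/has_stableP; exists (w, A).
  case: SfwA => /= + [s [/(weak_nil M0) -> _ _]].
  by rewrite M0 subset0 => ->.
split; first exact: sub0set.
have weak_s : weak (init M) (pmap id ls) s by exists ls.
by exists s; split=> //; rewrite -(weak_nil M0 weak_s).
Qed.

(** The empty word is the only trace and is divergent, and there are no infinite traces. Only the
    existence of a reachable stable state can vary, so [B] and [V] represent all cases. *)
Lemma cffd_empty_alphabet M N :
    alphabet M = set0 -> alphabet N = set0 ->
    diverges (init M) -> diverges (init N) -> (has_stable M <-> has_stable N) ->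
  cffd_equiv M N.
Proof.
move=> M0 N0 Mdiv Ndiv /propext MN; split; first by rewrite M0.
- by rewrite !Sf_empty_alphabet // MN.
- by rewrite !Div_empty_alphabet.
- by rewrite !Inf_empty_alphabet.
Qed.

Lemma diverges_V : diverges (init (lts_V Act)).
Proof. by exists (fun=> tt). Qed.

Lemma diverges_B : diverges (init (lts_B Act)).
Proof. by exists (fun=> B_s0) => // i; exact: B_trans00. Qed.

Lemma no_stable_V : ~ has_stable (lts_V Act).
Proof. by case=> s _ /(_ tt); apply. Qed.

Lemma has_stable_B : has_stable (lts_B Act).
Proof.
exists B_s1; last by move=> s' st; inversion st.
by exists [:: None]; exists B_s1 => //; exact: B_trans01.
Qed.

End EmptyAlphabet.

(** * The tester and its hidden composition with an LTS *)

Section Tester.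
Variables (Act : Type) (sigma : seq Act) (A : set Act).

(* [Todo w]: the suffix [w] of [sigma] remains to be performed. *)
Inductive tester_state := Start | Todo of seq Act | Failed.

Inductive tester_trans : tester_state -> option Act -> tester_state -> Prop :=
  | StartLoop : tester_trans Start None Start
  | StartTodo : tester_trans Start None (Todo sigma)
  | TodoLoop b w : tester_trans (Todo (b :: w)) None (Todo (b :: w))
  | TodoStep b w : tester_trans (Todo (b :: w)) (Some b) (Todo w)
  | TodoFail a : A a -> tester_trans (Todo [::]) (Some a) Failed
  | FailedLoop : tester_trans Failed None Failed.

Lemma tester_alphabet s a s' : tester_trans s (Some a) s' -> [set: Act] a.
Proof. by []. Qed.

(** With the full alphabet, each visible action of [K] must synchronise, and actions foreign to [K]
    are left to the tester alone. *)
Definition tester : LTS Act :=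
  {| state := tester_state;
     alphabet := [set: Act];
     trans := tester_trans;
     init := Start;
     trans_alphabet := tester_alphabet |}.

Definition tested (K : LTS Act) : LTS Act := hide (par K tester) [set: Act].

Section Tested.
Variable K : LTS Act.

Lemma tested_alphabet : alphabet (tested K) = set0.
Proof. by rewrite /= setDT. Qed.

Lemma tested_tester_tau (s : state K) t t' :
  tester_trans t None t' -> @trans _ (tested K) (s, t) None (s, t').
Proof. by move=> tt'; left; apply: Or33; split. Qed.

Lemma tested_tau (s s' : state K) t :
  trans s None s' -> @trans _ (tested K) (s, t) None (s', t).
Proof. by move=> ss'; left; apply: Or32; split. Qed.

Lemma tested_sync (s s' : state K) a t t' :
    trans s (Some a) s' -> tester_trans t (Some a) t' ->
  @trans _ (tested K) (s, t) None (s', t').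
Proof.
move=> ss' tt'; right; exists a => //; apply: Or31; split=> //.
by split=> //; exact: trans_alphabet ss'.
Qed.

Lemma tested_tester_alone (s : state K) a t t' :
    ~ alphabet K a -> tester_trans t (Some a) t' ->
  @trans _ (tested K) (s, t) None (s, t').
Proof.
by move=> Ka tt'; right; exists a => //; apply: Or33; split=> // -[].
Qed.

Variant tested_trans_spec (s s' : state K) (t t' : tester_state) : Prop :=
  | TestedTesterTau of s' = s & tester_trans t None t'
  | TestedTau of trans s None s' & t' = t
  | TestedSync a of trans s (Some a) s' & tester_trans t (Some a) t'
  | TestedAlone a of ~ alphabet K a & s' = s & tester_trans t (Some a) t'.

Lemma tested_transP (s s' : state K) t t' l :
  @trans _ (tested K) (s, t) l (s', t') -> tested_trans_spec s s' t t'.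
Proof.
case: l => [a [_ []]//|[]].
  by case=> -[//= _ st E]; [exact: TestedTau | exact: TestedTesterTau].
case=> a _ [] [/= Ka st tt'].
- exact: TestedSync st tt'.
- by case: Ka; split=> //; exact: trans_alphabet st.
- by apply: TestedAlone tt' st => Ka'; exact: Ka.
Qed.

Lemma diverges_tested : diverges (init (tested K)).
Proof.
exists (fun=> (init K, Start)) => // i; apply: tested_tester_tau.
exact: StartLoop.
Qed.

Lemma run_tested (s : state K) ls s' : run s ls s' ->
  exists ls', @run _ (tested K) (s, Todo (pmap id ls)) ls' (s', Todo [::]).
Proof.
elim: ls s => [|l ls IH] s /=; first by move=> ->; exists [::].
case=> t + /IH[ls' run'] => st; exists (None :: ls').
exists (t, Todo (pmap id ls)) => //.
case: l st => [a|] st; last exact: tested_tau.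
by apply: tested_sync st _; exact: TodoStep.
Qed.

(** Once [sigma] is completed, the tester offers only actions of [A]. They all belong to [K], so
    they need its participation, which the stable state refuses. *)
Lemma Sf_has_stable_tested : Sf K (sigma, A) -> has_stable (tested K).
Proof.
case=> /= AK [s [[ls /run_tested[ls' run'] lsE] stable_s refuses]].
exists (s, Todo [::]).
  exists (None :: ls'); exists (init K, Todo sigma); last by rewrite -lsE.
  by apply: tested_tester_tau; exact: StartTodo.
case=> s' t' /tested_transP[] => [_ tt'|/stable_s//|a st tt'|a Ka _ tt'].
- by inversion tt'.
- by inversion tt' as [| | | |? Aa|]; exact: refuses Aa _ st.
- by inversion tt' as [| | | |? Aa|]; apply: Ka; exact: AK.
Qed.

(** Invariant of the reachable states. The equation is conditional because letters of [sigma]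
    foreign to [K] are missing from [sigma']. *)
Definition progress (p : state K * tester_state) : Prop :=
  match p.2 with
  | Start => weak (init K) [::] p.1
  | Todo w => exists2 sigma', weak (init K) sigma' p.1 &
      [set a | List.In a sigma] `<=` alphabet K -> sigma' ++ w = sigma
  | Failed => True
  end.

Lemma progress_step p l p' :
  progress p -> @trans _ (tested K) p l p' -> progress p'.
Proof.
case: p p' => [s t] [s' t'] + /tested_transP; rewrite /progress /=.
move=> + [-> tt'|st ->|a st tt'|a Ka -> tt'].
- by inversion tt' => //; exists [::].
- case: t => [||//]; first by move/weak_tau; apply.
  by move=> w [sigma' /weak_tau/(_ st) ? ?]; exists sigma'.
- inversion tt' => // -[sigma' init_s E]; exists (rcons sigma' a).
    exact: weak_rcons st.
  by move=> /E; rewrite cat_rcons.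
- inversion tt' as [| | |b w| |] => // -[sigma' init_s E]; exists sigma' => //.
  (* The action performed alone is a letter of [sigma], so [sigmaK] puts it in the alphabet of
     [K]. *)
  move=> sigmaK; case: Ka; apply: (sigmaK) => /=; rewrite -(E sigmaK).
  by apply/List.in_or_app; right; left.
Qed.

Lemma has_stable_tested_Sf : has_stable (tested K) ->
  exists2 sigma', Sf K (sigma', A) &
    [set a | List.In a sigma] `<=` alphabet K -> sigma' = sigma.
Proof.
case=> -[s t] [ls init_st] stable_st.
have: progress (s, t).
  by apply: run_inv init_st; [exact: progress_step | exact: weak_refl].
have noloop : ~ tester_trans t None t.
  by move=> tt; apply: (stable_st (s, t)); exact: tested_tester_tau.
case: t noloop stable_st {init_st} => [[]|[|b w]|[]].
- exact: StartLoop.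
- move=> _ stable_st [sigma' init_s E]; exists sigma'; last first.
    by move=> /E; rewrite cats0.
  split=> [a Aa|] /=.
    apply: contrapT => Ka; apply: (stable_st (s, Failed)).
    by apply: tested_tester_alone Ka _; exact: TodoFail.
  exists s; split=> // [s' ss'|a Aa s' ss'].
    by apply: (stable_st (s', Todo [::])); exact: tested_tau.
  apply: (stable_st (s', Failed)).
  by apply: tested_sync ss' _; exact: TodoFail.
- by case; exact: TodoLoop.
- exact: FailedLoop.
Qed.

End Tested.
End Tester.

(** * Stable states under hiding *)

Section Hide.
Variables (Act : Type) (L : LTS Act) (A : set Act).

Lemma run_hide s ls s' :
  @run _ L s ls s' -> exists ls', @run _ (hide L A) s ls' s'.
Proof.
elim: ls s => [|l ls IH] s /=; first by exists [::].
case=> t st /IH[ls' ts']; case: l st => [a|] st; last first.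
  by exists (None :: ls'), t => //; left.
have [Aa|nAa] := pselect (A a); last by exists (Some a :: ls'), t.
by exists (None :: ls'), t => //; right; exists a.
Qed.

Lemma run_of_hide s ls s' :
  @run _ (hide L A) s ls s' -> exists ls', @run _ L s ls' s'.
Proof.
elim: ls s => [|l ls IH] s /=; first by exists [::].
case=> t + /IH[ls' ts'] => st; case: l st => [a [st _]|[st|[a _ st]]].
- by exists (Some a :: ls'), t.
- by exists (None :: ls'), t.
- by exists (Some a :: ls'), t.
Qed.

Lemma has_stable_hide_disjoint :
  A `&` alphabet L = set0 -> has_stable L -> has_stable (hide L A).
Proof.
move=> A0 [s [ls init_s] stable_s]; exists s; first exact: run_hide init_s.
move=> s' [/stable_s//|[a Aa ss']].
have : (A `&` alphabet L) a by split=> //; exact: trans_alphabet ss'.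
by rewrite A0.
Qed.

(** Actions of [A] become tau, so a state stable after hiding refuses all of [A]. *)
Lemma has_stable_hide_Sf : A `<=` alphabet L -> has_stable (hide L A) ->
  exists sigma, Sf L (sigma, A).
Proof.
move=> AL [s [ls /run_of_hide[ls' init_s]] stable_s].
exists (pmap id ls'); split=> //; exists s; split.
- by exists ls'.
- by move=> s' ss'; apply: (stable_s s'); left.
- by move=> a Aa s' ss'; apply: (stable_s s'); right; exists a.
Qed.

End Hide.

(** * Transfer of stable failures along the congruence *)

Section Congruence.
Variables (Act : Type) (cong : LTS Act -> LTS Act -> Prop).
Hypothesis hcong : is_congruence cong.
Hypothesis hcffd : forall L L' : LTS Act, cffd_equiv L L' -> cong L L'.
Hypothesis hBV : ~ cong (lts_B Act) (lts_V Act).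

Let cong_eqv := cong_equivalence hcong.

(** If [K'] failed the test that [K] passes, the two hidden compositions would be congruent to [V]
    and [B], making [B] and [V] congruent. *)
Lemma cong_test K K' sigma A : cong K K' -> Sf K (sigma, A) ->
  exists2 sigma', Sf K' (sigma', A) &
    [set a | List.In a sigma] `<=` alphabet K' -> sigma' = sigma.
Proof.
move=> KK' SfK; apply: has_stable_tested_Sf; apply: contrapT => K'unstable.
have KB : cong (tested sigma A K) (lts_B Act).
  apply/hcffd/cffd_empty_alphabet; rewrite ?tested_alphabet //.
  - exact: diverges_tested.
  - exact: diverges_B.
  - by split=> _; [exact: has_stable_B | exact: Sf_has_stable_tested].
have K'V : cong (tested sigma A K') (lts_V Act).
  apply/hcffd/cffd_empty_alphabet; rewrite ?tested_alphabet //.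
  - exact: diverges_tested.
  - exact: diverges_V.
  - by split=> // /no_stable_V.
have tKK' : cong (tested sigma A K) (tested sigma A K').
  by apply/(cong_hide hcong)/(cong_parl hcong).
apply: hBV; case: cong_eqv => _ sym trn.
exact: trn (trn _ _ _ (sym _ _ KB) tKK') K'V.
Qed.

Lemma cong_Sf_subset L L' : cong L L' -> Sf L `<=` Sf L'.
Proof.
move=> LL' [sigma A] SfL; have [sigma' SfL' E] := cong_test LL' SfL.
suff /E <- : [set a | List.In a sigma] `<=` alphabet L' by [].
move=> a sigma_a; apply: contrapT => L'a.
have La : alphabet L a.
  by case: SfL => _ [s [/weak_alphabet/(_ _ sigma_a)]].
(* A stable state would give [L], hence [L'], a failure with refusal set [[set a]], although [a] is
   not in the alphabet of [L']. *)
have hide_unstable : ~ has_stable (hide L [set a]).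
  case/has_stable_hide_Sf => [_ -> //|w /(cong_test LL')[w' [/= + _] _]].
  by move/(_ a erefl).
have /has_stableP[[w C] SfhL'] : has_stable (hide L' [set a]).
  apply: has_stable_hide_disjoint; first by rewrite -subset0 => b [/= ->].
  by apply/has_stableP; exists (sigma', A).
have hL'L : cong (hide L' [set a]) (hide L [set a]).
  by apply: (cong_hide hcong); case: cong_eqv => _ sym _; exact: sym.
(* Any failure of [hide L' [set a]] will do: its transfer gives [hide L [set a]] a stable state. *)
have [w' SfhL _] := cong_test hL'L SfhL'.
by apply/hide_unstable/has_stableP; exists (w', C).
Qed.

End Congruence.

Theorem theorem5p1 (Act : Type) (cong : LTS Act -> LTS Act -> Prop)
  (hcong : is_congruence cong)
  (hcffd : forall L L' : LTS Act, cffd_equiv L L' -> cong L L')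
  (hBV : ~ cong (lts_B Act) (lts_V Act)) :
  preserves cong (@Sf Act).
Proof.
move=> L L' LL'; apply/seteqP; split; first exact: (cong_Sf_subset hcong).
apply: (cong_Sf_subset hcong) => //.
by case: (cong_equivalence hcong) => _ sym _; exact: sym.
Qed.
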